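(* Let $K$ be a commutative field, let $x_1,\ldots,x_r\in K$ be pairwise distinct, let $m_1,\ldots,m_r$ be positive integers, put $n=m_1+\cdots+m_r$, and for each $i\in\{1,\ldots,r\}$ let $g_i\in K[t]$ be a given polynomial of degree $<m_i$. Let $\omega$ and $h_1,\ldots,h_r\in K[t]$ be the polynomials defined in the context. Then the unique solution $f\in K[t]$ to the Hermite interpolation problem with data $(x_i,m_i,g_i)$, $i=1,\ldots,r$, is the remainder modulo $\omega$ of the polynomial $$F(t)=\sum_{i=1}^{r} h_i(t)\,g_i(t).$$ In other words, $f\in K[t]$ is the unique polynomial with $\deg f<n$ such that $f(t)\equiv F(t) \bmod \omega$.
   Context: The Hermite interpolation problem with data $(x_i,m_i,g_i)$, $i=1,\ldots,r$, is to determine the unique polynomial $f\in K[t]$ of degree $<n$ satisfying $$f^{(k)}(x_i)=g_i^{(k)}(x_i),\qquad 0\le k<m_i,\quad i=1,\ldots,r,$$ where $f^{(k)}$ denotes the $k$-th formal derivative of $f$. Notation: $\omega(t)=\prod_{j=1}^r (t-x_j)^{m_j}$. For each $i\in\{1,\ldots,r\}$ set $$\phi_i(t)=\prod_{j\ne i}(t-x_j)^{m_j},\qquad q_i(t)=\frac{\phi_i(t)}{\phi_i(x_i)},\qquad h_i(t)=1-\left(1-q_i(t)\right)^{m_i}=1-\left(1-\prod_{j\ne i}\left(\frac{t-x_j}{x_i-x_j}\right)^{m_j}\right)^{m_i}.$$ The polynomials $h_i$ are called the basic Hermite interpolation polynomials associated with the data.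
   Formalization: Uniqueness with ordinary formal derivatives fails if 0 < char K < m_i for some i (K=F_2, m_1=3, g_1=0: f=0 and f=t^2), so it is claimed only when char K is 0 or at least every m_i; for divided (Hasse) derivatives it is proved over every field. *)

(* Defs.v *)
From HB Require Import structures.
From mathcomp Require Import all_boot all_order all_algebra.

Set Implicit Arguments.
Unset Strict Implicit.
Unset Printing Implicit Defensive.

Import GRing.Theory.
Local Open Scope ring_scope.

Section Hermite.

Variables (K : fieldType) (r : nat).
Variables (x : 'I_r -> K) (m : 'I_r -> nat).

Definition hermite_omega : {poly K} :=
  \prod_(j < r) ('X - (x j)%:P) ^+ m j.

Definition hermite_phi (i : 'I_r) : {poly K} :=
  \prod_(j < r | j != i) ('X - (x j)%:P) ^+ m j.

Definition hermite_q (i : 'I_r) : {poly K} :=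
  ((hermite_phi i).[x i])^-1 *: hermite_phi i.

Definition hermite_h (i : 'I_r) : {poly K} :=
  1 - (1 - hermite_q i) ^+ m i.

Variable g : 'I_r -> {poly K}.

Definition hermite_F : {poly K} := \sum_(i < r) hermite_h i * g i.

(* Since size p = deg p + 1 (and size 0 = 0), deg f < n reads size f <= n. *)
Definition hermite_solution (f : {poly K}) : Prop :=
  (size f <= \sum_(i < r) m i)%N /\
  forall (i : 'I_r) (k : nat), (k < m i)%N -> f^`(k).[x i] = (g i)^`(k).[x i].

(* The same problem with the divided (Hasse) derivatives f^(k) / k!.  The two
   agree when every k! with k < m i is invertible in K; in characteristic
   0 < p < m i the ordinary p-th derivative is identically zero, so ordinary
   derivatives no longer determine f, whereas divided ones always do. *)
Definition hermite_solution_divided (f : {poly K}) : Prop :=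
  (size f <= \sum_(i < r) m i)%N /\
  forall (i : 'I_r) (k : nat), (k < m i)%N ->
    f^`N(k).[x i] = (g i)^`N(k).[x i].

End Hermite.

(* Main.v *)
Require Import Defs.
From HB Require Import structures.
From mathcomp Require Import all_boot all_order all_algebra.

Set Implicit Arguments.
Unset Strict Implicit.
Unset Printing Implicit Defensive.

Import GRing.Theory.
Local Open Scope ring_scope.

(** The argument is local.  A polynomial is determined modulo [('X - a)^m] by
its first [m] Taylor coefficients at [a], that is by the values at [a] of its
divided derivatives of order less than [m] ([eqmod_expXsubC_nderivnP]).  So
Hermite data with divided derivatives prescribe a residue modulo each
[('X - x i)^(m i)].  The points being distinct, these moduli are pairwise
coprime with product [omega], and the whole problem becomes one congruence
modulo [omega], by the Chinese remainder theorem ([dvdp_prod_coprime]).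

The polynomials [h i] are Chinese remainder idempotents: [1 - q i] vanishes
at [x i], hence [h i = 1 - (1 - q i)^(m i)] is [1] modulo [('X - x i)^(m i)];
and [h i] is a multiple of [q i], so it is [0] modulo [('X - x j)^(m j)] for
[j != i].  Therefore [F] is [g i] modulo [('X - x i)^(m i)], and a polynomial
of degree less than [n] solves the divided problem exactly when it is
congruent to [F] modulo [omega] ([hermite_solution_dividedP]), which singles
out the remainder of [F].

The [k]-th derivative is [k!] times the divided one.  A divided solution is
thus always a solution, and the converse holds when the factorials [k!],
[k < m i], are nonzero in the field, as they are under the bound on the
characteristic ([hermite_solution_to_divided]). *)

(** Taylor's formula for polynomials over [{poly R}], at the constant [a] and
with increment ['X]. *)
Lemma coef_comp_polyXaddC (R : comNzRingType) (p : {poly R}) (a : R) (k : nat) :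
  (p \Po ('X + a%:P))`_k = p^`N(k).[a].
Proof.
rewrite /comp_poly addrC nderiv_taylor; last exact: mulrC.
rewrite size_map_polyC.
under eq_bigr => i _ do rewrite nderivn_map horner_map /= mul_polyC.
rewrite -(poly_def (size p) (fun i => p^`N(i).[a])) coef_poly.
by case: ltnP => // le_pk; rewrite nderivn_poly0 // horner0.
Qed.

Lemma dvdp_XnP (F : fieldType) (p : {poly F}) (m : nat) :
  reflect (forall k, (k < m)%N -> p`_k = 0) ('X^m %| p).
Proof.
apply: (iffP idP) => [/dvdpP[q ->] k lt_km | p0].
  by rewrite coefMXn lt_km.
rewrite -(poly_take_drop m p) (_ : take_poly m p = 0) ?add0r ?dvdp_mull //.
by apply/polyP => k; rewrite coef_take_poly coef0; case: ltnP => // /p0.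
Qed.

(** The translation moving [a] to [0] reduces this to divisibility by a power
of ['X]. *)
Lemma dvdp_expXsubC_nderivnP (F : fieldType) (p : {poly F}) (a : F) (m : nat) :
  reflect (forall k, (k < m)%N -> p^`N(k).[a] = 0) (('X - a%:P) ^+ m %| p).
Proof.
have ->: (('X - a%:P) ^+ m %| p) = ('X^m %| p \Po ('X + a%:P)).
  apply/idP/idP.
  - move/(dvdp_comp_poly ('X + a%:P)).
    by rewrite rmorphXn /= comp_polyB comp_polyX comp_polyC addrK.
  - move/(dvdp_comp_poly ('X - a%:P)).
    by rewrite comp_polyXaddC_K rmorphXn /= comp_polyX.
apply: (iffP (dvdp_XnP _ _)) => p0 k /p0;
  by rewrite coef_comp_polyXaddC.
Qed.

Lemma eqmod_expXsubC_nderivnP (F : fieldType) (p q : {poly F}) (a : F)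
    (m : nat) :
  reflect (forall k, (k < m)%N -> p^`N(k).[a] = q^`N(k).[a])
          (('X - a%:P) ^+ m %| p - q).
Proof.
apply: (iffP (dvdp_expXsubC_nderivnP _ _ _)) => eq_pq k /eq_pq.
  by rewrite nderivnB hornerD hornerN => /subr0_eq.
by rewrite nderivnB hornerD hornerN => ->; rewrite subrr.
Qed.

Lemma dvdp_prod_coprime (F : fieldType) (I : eqType) (s : seq I)
    (d : I -> {poly F}) (p : {poly F}) :
    uniq s -> (forall i j, i != j -> coprimep (d i) (d j)) ->
  reflect (forall i, i \in s -> d i %| p) (\prod_(i <- s) d i %| p).
Proof.
move=> s_uniq d_coprime; apply: (iffP idP) => [dvd_p i si | ].
  by apply: dvdp_trans dvd_p; rewrite (big_rem i) //= dvdp_mulr.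
elim: s s_uniq => [_ _ | i s IHs /= /andP[s'i s_uniq] dvd_p].
  by rewrite big_nil dvd1p.
rewrite big_cons Gauss_dvdp.
  rewrite dvd_p ?mem_head //= IHs // => j sj.
  by rewrite dvd_p // inE sj orbT.
rewrite big_seq; elim/big_rec: _ => [|j q sj co_iq]; first exact: coprimep1.
by rewrite coprimepMr co_iq andbT d_coprime //; apply: contraNneq s'i => ->.
Qed.

Lemma coprimep_expXsubC (F : fieldType) (a b : F) (m n : nat) :
  a != b -> coprimep (('X - a%:P) ^+ m) (('X - b%:P) ^+ n).
Proof.
move=> neq_ab; apply/coprimep_expl/coprimep_expr/coprimep_XsubC2.
by rewrite subr_eq0 eq_sym.
Qed.

Section HermiteInterpolation.

Variables (K : fieldType) (r : nat) (x : 'I_r -> K) (m : 'I_r -> nat).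
Hypothesis x_inj : injective x.

Lemma dvdp_hermite_omegaP (p : {poly K}) :
  reflect (forall i, ('X - (x i)%:P) ^+ m i %| p) (hermite_omega x m %| p).
Proof.
apply: (iffP (dvdp_prod_coprime _ _ _)) => [|i j neq_ij|dvd_p i|dvd_p i _].
- exact: index_enum_uniq.
- by apply: coprimep_expXsubC; rewrite (inj_eq x_inj).
- exact/dvd_p/mem_index_enum.
- exact: dvd_p.
Qed.

Lemma size_hermite_omega : size (hermite_omega x m) = (\sum_(i < r) m i).+1.
Proof.
rewrite /hermite_omega.
elim/big_ind2: _ => [|n1 p1 n2 p2 sz1 sz2|i _]; last exact: size_exp_XsubC.
  by rewrite size_poly1.
by rewrite size_mul ?sz1 ?sz2 ?addnS // -size_poly_gt0 ?sz1 ?sz2.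
Qed.

Lemma horner_hermite_q i : (hermite_q x m i).[x i] = 1.
Proof.
rewrite hornerZ mulVf // horner_prod; apply/prodf_neq0 => j neq_ji.
rewrite horner_exp hornerXsubC expf_neq0 // subr_eq0.
by rewrite (inj_eq x_inj) eq_sym.
Qed.

Lemma hermite_h_eqmod1 i :
  ('X - (x i)%:P) ^+ m i %| hermite_h x m i - 1.
Proof.
rewrite /hermite_h addrAC subrr add0r dvdpNr dvdp_exp2r // dvdp_XsubCl.
by rewrite rootE hornerD hornerN hornerC horner_hermite_q subrr.
Qed.

(** [1 - (1 - q)^m] is divisible by [q], through the factorization of
[y^m - 1] at [y = 1 - q]. *)
Lemma hermite_h_eqmod0 i j :
  j != i -> ('X - (x j)%:P) ^+ m j %| hermite_h x m i.
Proof.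
move=> neq_ji; apply: (@dvdp_trans _ (hermite_q x m i)).
  rewrite /hermite_q -mul_polyC dvdp_mull //.
  by rewrite /hermite_phi (bigD1 j) //= dvdp_mulIl.
rewrite /hermite_h -opprB subrX1 addrAC subrr add0r mulNr opprK.
exact: dvdp_mulIl.
Qed.

Variable g : 'I_r -> {poly K}.

Lemma hermite_F_eqmod i :
  ('X - (x i)%:P) ^+ m i %| hermite_F x m g - g i.
Proof.
rewrite /hermite_F (bigD1 i) //= addrAC -{2}[g i]mul1r -mulrBl.
rewrite dvdp_add ?dvdp_mulr ?hermite_h_eqmod1 //.
elim/big_rec: _ => [|j p neq_ji dvd_p]; first exact: dvdp0.
by rewrite dvdp_add // dvdp_mulr // hermite_h_eqmod0 // eq_sym.
Qed.

Lemma hermite_solution_dividedP (u : {poly K}) :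
  hermite_solution_divided x m g u <->
  (size u <= \sum_(i < r) m i)%N /\ hermite_omega x m %| u - hermite_F x m g.
Proof.
have subF i : u - hermite_F x m g = (u - g i) - (hermite_F x m g - g i).
  by rewrite opprB addrA subrK.
split=> -[size_u eq_u]; split=> //.
  apply/dvdp_hermite_omegaP => i; rewrite (subF i) dvdp_sub ?hermite_F_eqmod //.
  exact/eqmod_expXsubC_nderivnP/eq_u.
move=> i; apply/eqmod_expXsubC_nderivnP.
rewrite -(subrK (hermite_F x m g) u) -addrA dvdp_add ?hermite_F_eqmod //.
exact: (dvdp_hermite_omegaP _ eq_u).
Qed.

Lemma hermite_solution_of_divided (u : {poly K}) :
  hermite_solution_divided x m g u -> hermite_solution x m g u.
Proof.
case=> size_u eq_u; split=> // i k /eq_u.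
by rewrite !nderivn_def !hornerMn => ->.
Qed.

Lemma hermite_solution_to_divided (u : {poly K}) :
    (forall i k, (k < m i)%N -> k`!%:R != 0 :> K) ->
  hermite_solution x m g u -> hermite_solution_divided x m g u.
Proof.
move=> fact_neq0 [size_u eq_u]; split=> // i k lt_km.
have := eq_u i k lt_km; rewrite !nderivn_def !hornerMn.
by rewrite -mulr_natr -[RHS]mulr_natr => /(mulIf (fact_neq0 i k lt_km)).
Qed.

End HermiteInterpolation.

(** In positive characteristic [p], the factors of [k!] are positive and less
than [p]. *)
Lemma natf_fact_neq0 (F : fieldType) (k : nat) :
  (forall p, p \in [pchar F] -> (k < p)%N) -> k`!%:R != 0 :> F.
Proof.
move=> lt_kp; rewrite fact_prod natr_prod prodf_seq_neq0.
apply/allP => i; rewrite mem_index_iota ltnS => /andP[i_gt0 le_ik] /=.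
apply/negP => i0; have [p charFp] := natf0_pchar i_gt0 i0.
rewrite -(dvdn_pcharf charFp) in i0.
by have := leq_trans (lt_kp p charFp) (dvdn_leq i_gt0 i0); rewrite ltnNge le_ik.
Qed.

Lemma modp_unique_residue (F : fieldType) (d p : {poly F}) (n : nat) :
    size d = n.+1 ->
  unique (fun u : {poly F} => (size u <= n)%N /\ d %| u - p) (p %% d).
Proof.
move=> size_d; have d_neq0: d != 0 by rewrite -size_poly_gt0 size_d.
split=> [|u [size_u dvd_u]].
  split; first by rewrite -ltnS -size_d ltn_modp.
  by rewrite {2}(divp_eq p d) opprD addrCA subrr addr0 dvdpNr dvdp_mull.
rewrite -(subrK p u) in size_u *.
by rewrite -[RHS](@modp_small _ _ d) ?size_d // modpD (modp_eq0 dvd_u) add0r.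
Qed.

Theorem theorem3p1 (K : fieldType) (r : nat) (x : 'I_r -> K) (m : 'I_r -> nat)
    (g : 'I_r -> {poly K}) (x_inj : injective x)
    (m_gt0 : forall i, (0 < m i)%N)
    (deg_g : forall i, (size (g i) <= m i)%N) :
  let n := (\sum_(i < r) m i)%N in
  let omega := hermite_omega x m in
  let F := hermite_F x m g in
  let f := F %% omega in
  [/\ hermite_solution x m g f,
      (forall (p : nat), p \in [pchar K] -> forall i, (m i <= p)%N) ->
        unique (hermite_solution x m g) f,
      unique (hermite_solution_divided x m g) f
    & unique (fun u : {poly K} => (size u <= n)%N /\ omega %| u - F) f].
Proof.
move=> n omega F f.
have [[size_f dvd_f] uniq_f] :
    unique (fun u : {poly K} => (size u <= n)%N /\ omega %| u - F) f.
  exact/modp_unique_residue/size_hermite_omega.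
have sol_f : hermite_solution_divided x m g f.
  exact/hermite_solution_dividedP.
have uniq_sol u : hermite_solution_divided x m g u -> f = u.
  by move/(hermite_solution_dividedP _ x_inj)/uniq_f.
split=> //.
  exact: hermite_solution_of_divided.
move=> pchar_ge; split=> [|u sol_u]; first exact: hermite_solution_of_divided.
apply/uniq_sol/hermite_solution_to_divided => // i k lt_km.
by apply: natf_fact_neq0 => p /pchar_ge/(_ i); apply: leq_trans.
Qed.
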